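(* Let $\mathcal{A}$ be a Banach algebra such that $\mathrm{rad}(\mathcal{A})=\mathrm{rann}(\mathcal{A})$ and $\mathcal{A}/\mathrm{rad}(\mathcal{A})$ is commutative, and suppose $\mathcal{A}$ has a right identity. Let $(\delta,d)$ be a generalized derivation of $\mathcal{A}$. Then the following are equivalent: (i) $[[\delta(a),a],\delta(a)]\in Z(\mathcal{A})$ for all $a\in\mathcal{A}$; (ii) $d\perp\delta$; (iii) $(\delta^2,d^2)$ is a generalized derivation of $\mathcal{A}$.
   Context: $\mathrm{rad}(\mathcal{A})$ is the Jacobson radical and $\mathrm{rann}(\mathcal{A})=\{c\in\mathcal{A}: ac=0\ \forall a\in\mathcal{A}\}$. A derivation is a linear map $d$ with $d(ab)=d(a)b+ad(b)$; a generalized derivation $(\delta,d)$ consists of a derivation $d$ and a linear $\delta$ with $\delta(ab)=a\delta(b)+d(a)b$ for all $a,b$. $Z(\mathcal{A})$ is the center, $[x,y]=xy-yx$. Maps $T,S:\mathcal{A}\to\mathcal{A}$ are orthogonal, $T\perp S$, if $T(a)cS(b)=S(b)cT(a)=0$ for all $a,b,c\in\mathcal{A}$. *)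

(* Defs.v *)
From HB Require Import structures.
From mathcomp Require Import all_boot all_order all_algebra.
From mathcomp Require Import all_classical all_reals all_analysis.
From mathcomp Require Import complex.
Set Implicit Arguments. Unset Strict Implicit. Unset Printing Implicit Defensive.
Import Order.TTheory GRing.Theory Num.Theory.
Import numFieldNormedType.Exports.
Local Open Scope ring_scope.

Section BanachAlgebra.
Variable (K : numFieldType) (V : normedModType K).
Variable mul : V -> V -> V.
Local Notation "x ** y" := (mul x y) (at level 40, left associativity).

(* A (not necessarily unital, not necessarily commutative) normed algebra
   structure on the normed space V: associative, bilinear, submultiplicative.
   Completeness of V is imposed by taking V : completeNormedModType. *)
Definition is_normed_algebra_mul : Prop :=
  [/\ associative mul,
      forall a, linear (mul a),
      forall b, linear (fun a => a ** b)
    & forall a b, `|a ** b| <= `|a| * `|b| ].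

Definition quasi_invertible (x : V) : Prop :=
  exists y : V, x + y - x ** y = 0 /\ y + x - y ** x = 0.

Definition jacobson_rad : set V :=
  [set x | forall a : V, quasi_invertible (a ** x)].

Definition rann : set V := [set c | forall a : V, a ** c = 0].

Definition alg_center : set V := [set z | forall x : V, z ** x = x ** z].

Definition alg_commutator (x y : V) : V := x ** y - y ** x.

Definition is_derivation (d : V -> V) : Prop :=
  linear d /\ forall a b, d (a ** b) = d a ** b + a ** d b.

Definition is_generalized_derivation (delta d : V -> V) : Prop :=
  [/\ is_derivation d, linear delta
    & forall a b, delta (a ** b) = a ** delta b + d a ** b].

Definition maps_orthogonal (T S : V -> V) : Prop :=
  forall a b c, (T a ** c) ** S b = 0 /\ (S b ** c) ** T a = 0.

End BanachAlgebra.

(* Main.v *)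
Require Import Defs.
From HB Require Import structures.
From mathcomp Require Import all_boot all_order all_algebra.
From mathcomp Require Import all_classical all_reals all_analysis.
From mathcomp Require Import complex ring lra.
Set Implicit Arguments. Unset Strict Implicit. Unset Printing Implicit Defensive.
Import Order.TTheory GRing.Theory Num.Theory.
Import numFieldNormedType.Exports.
Local Open Scope ring_scope.
Local Open Scope complex_scope.
Import Normc.

(** Let [N = rann A].  Since [rad A = N] and [a - e a] lies in [N], the corner [e A] is a complement
    of [N]; it is a commutative unital semisimple Banach algebra on which [e d] is a derivation.
    By Johnson's theorem this derivation is [0], so [d] maps [A] into [N].  Writing
    [delta a = a u + d a] with [u = delta e], each of the three conditions then reduces to
    [d a u = 0] for all [a].

    Johnson's theorem for a derivation [D] of such an algebra [B]: let [S] be the separating space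
    of [D].  By a gliding hump argument the closures of [b_1 ... b_n S] stabilise, so a nonzero [S]
    has a multiple [a S] for which every [a b S] is zero or dense in [a S].  Semisimplicity then
    puts in [S] an idempotent [p] such that [p B] is a field, so [p B = C p] by the Gelfand-Mazur
    theorem; as [D p = 0], this contradicts [p] being in [S].  So [S = 0], [D] is bounded by the
    closed graph theorem, and the Kleinecke-Shirokov argument makes every [b D a] quasi-nilpotent. *)

(** * Banach norms on commutative algebras *)

Section BanachNorm.
Variables (R : realType) (B : comAlgType R[i]).

Definition norm_complete (N : B -> R) : Prop :=
  forall u : nat -> B,
    (forall eps, 0 < eps -> exists n0, forall m n,
        (n0 <= m)%N -> (n0 <= n)%N -> N (u m - u n) < eps) ->
  exists l, forall eps, 0 < eps -> exists n0, forall n,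
        (n0 <= n)%N -> N (u n - l) < eps.

(** The value of [N 1] is left free, since the unit [e] of the corner may have norm above 1. *)
Definition banach_norm (N : B -> R) : Prop :=
  [/\ forall x y, N (x + y) <= N x + N y,
      forall k x, N (k *: x) = normc k * N x,
      forall x y, N (x * y) <= N x * N y,
      forall x, N x = 0 -> x = 0
    & norm_complete N].

Definition invertible (x : B) : Prop := exists y, x * y = 1.

(** In a commutative unital ring the [x] with every [1 - b * x] invertible form the Jacobson
    radical. *)
Definition semisimple_alg : Prop :=
  forall x, (forall b, invertible (1 - b * x)) -> x = 0.

End BanachNorm.

Section Basics.
Variables (R : realType) (B : comAlgType R[i]) (N : B -> R).
Hypothesis bN : banach_norm N.

Lemma bnormD x y : N (x + y) <= N x + N y. Proof. by case: bN. Qed.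
Lemma bnormZ k x : N (k *: x) = normc k * N x. Proof. by case: bN. Qed.
Lemma bnormM x y : N (x * y) <= N x * N y. Proof. by case: bN. Qed.
Lemma bnorm_eq0 x : N x = 0 -> x = 0. Proof. by case: bN => ? ? ? + ?; apply. Qed.

Lemma normc_real (r : R) : normc r%:C = `|r|.
Proof. by rewrite /normc /= expr0n /= addr0 sqrtr_sqr. Qed.

Lemma bnormZ_real (r : R) x : N (r%:C *: x) = `|r| * N x.
Proof. by rewrite bnormZ normc_real. Qed.

Lemma bnorm0 : N 0 = 0.
Proof. by rewrite -(scale0r (0 : B)) bnormZ normc0 mul0r. Qed.

Lemma bnormN x : N (- x) = N x.
Proof. by rewrite -scaleN1r bnormZ normcN normc1 mul1r. Qed.

Lemma bnormB x y : N (x - y) <= N x + N y.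
Proof. by rewrite -(bnormN y) bnormD. Qed.

Lemma bnorm_distC x y : N (x - y) = N (y - x).
Proof. by rewrite -bnormN opprB. Qed.

Lemma bnorm_ge0 x : 0 <= N x.
Proof. by have := bnormB x x; rewrite subrr bnorm0; lra. Qed.

Lemma bnorm_triangle x y z : N (x - z) <= N (x - y) + N (y - z).
Proof. by have := bnormD (x - y) (y - z); rewrite addrA subrK. Qed.

Lemma bnorm_small_eq0 x : (forall eps, 0 < eps -> N x < eps) -> x = 0.
Proof.
move=> H; apply: bnorm_eq0; apply/eqP; case: (ltrgt0P (N x)) => // h.
  by have := H _ h; rewrite ltxx.
by have := bnorm_ge0 x; lra.
Qed.

Lemma bnorm1_gt0 : 0 < N 1.
Proof.
rewrite lt_neqAle bnorm_ge0 andbT eq_sym; apply/eqP => /bnorm_eq0 /eqP.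
by rewrite oner_eq0.
Qed.

Lemma geometric_lt (c : R) : 0 <= c -> forall eps, 0 < eps ->
  exists n, c * 2^-1 ^+ n < eps.
Proof.
move=> c0 eps e0.
have [n hn] : exists n : nat, c / eps < n%:R.
  by exists (Num.truncn (c / eps)).+1; rewrite truncnS_gt.
exists n; have h2 : n%:R <= (2 : R) ^+ n by rewrite -natrX ler_nat ltnW // ltn_expl.
have p2 : 0 < (2 : R) ^+ n by rewrite exprn_gt0.
rewrite exprVn ltr_pdivrMr // mulrC.
by have := lt_le_trans hn h2; rewrite ltr_pdivrMr.
Qed.

Lemma geometric_cvg (u : nat -> B) (c : R) :
  (forall n, N (u n.+1 - u n) <= c * 2^-1 ^+ n) ->
  exists l, forall n, N (u n - l) <= 2 * c * 2^-1 ^+ n.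
Proof.
move=> hu.
have c0 : 0 <= c by have := hu 0%N; have := bnorm_ge0 (u 1 - u 0); rewrite expr0; lra.
have p2 n : 0 < (2^-1 : R) ^+ n by rewrite exprn_gt0 // invr_gt0.
(* The bound telescopes: the step [c * 2^-1 ^+ (n + k)] is exactly the decrease of
   [2 * c * 2^-1 ^+ (n + k)]. *)
have tail n k : N (u (n + k)%N - u n) <= 2 * c * 2^-1 ^+ n - 2 * c * 2^-1 ^+ (n + k).
  elim: k => [|k IH]; first by rewrite addn0 !subrr bnorm0.
  rewrite addnS; apply: le_trans (bnorm_triangle _ (u (n + k)%N) _) _.
  by have := hu (n + k)%N; rewrite exprS; lra.
have tail' n m : (n <= m)%N -> N (u m - u n) <= 2 * c * 2^-1 ^+ n.
  move=> nm; rewrite -(subnKC nm); apply: le_trans (tail _ _) _.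
  by rewrite gerBl; apply: mulr_ge0; [lra | exact: ltW].
have [l hl] : exists l, forall eps, 0 < eps -> exists n0, forall n,
        (n0 <= n)%N -> N (u n - l) < eps.
  case: bN => _ _ _ _; apply => eps e0.
  have [n0 hn0] : exists n, 4 * c * 2^-1 ^+ n < eps by apply: geometric_lt => //; lra.
  exists n0 => m n hm hn.
  apply: le_lt_trans (bnorm_triangle _ (u n0) _) _; rewrite (bnorm_distC (u n0)).
  by have := tail' _ _ hm; have := tail' _ _ hn; lra.
exists l => n; rewrite leNgt; apply/negP => h.
have [|n0 /(_ (maxn n0 n) (leq_maxl _ _)) hn0] :=
  hl (N (u n - l) - 2 * c * 2^-1 ^+ n); first by rewrite subr_gt0.
have := bnorm_triangle (u n) (u (maxn n0 n)) l; have := tail' _ _ (leq_maxr n0 n).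
by rewrite (bnorm_distC (u n) (u _)); lra.
Qed.

Lemma neumann_invertible q : N q <= 2^-1 -> invertible (1 - q).
Proof.
move=> hq; pose u n := \sum_(i < n) q ^+ i.
have pq n : N (q ^+ n) <= N 1 * 2^-1 ^+ n.
  elim: n => [|n IH]; first by rewrite !expr0 mulr1.
  rewrite exprS; apply: le_trans (bnormM _ _) _; rewrite exprS mulrCA.
  by apply: ler_pM => //; exact: bnorm_ge0.
have [|l hl] := @geometric_cvg u (N 1).
  by move=> n; rewrite /u big_ord_recr /= addrC addrK.
exists l; apply/eqP; rewrite -subr_eq0; apply/eqP; apply: bnorm_small_eq0 => eps e0.
have [n hn] : exists n, (N (1 - q) * (2 * N 1) + N 1) * 2^-1 ^+ n < eps.
  by apply: geometric_lt => //; have := bnorm_ge0 (1 - q); have := bnorm1_gt0; nra.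
have -> : (1 - q) * l - 1 = - (1 - q) * (u n - l) - q ^+ n.
  have : 1 - q ^+ n = (1 - q) * u n by rewrite -opprB subrX1 -mulNr opprB.
  move=> h; transitivity ((1 - q) * l - (1 - q ^+ n) - q ^+ n); first ring.
  rewrite h; ring.
apply: le_lt_trans (bnormB _ _) _; apply: le_lt_trans hn.
rewrite mulrDl lerD ?pq // -mulrA.
apply: le_trans (bnormM _ _) _; rewrite bnormN ler_wpM2l ?bnorm_ge0 ?mulrA //.
Qed.

End Basics.

(** * The separating space of a derivation *)

Section Separating.
Variables (R : realType) (B : comAlgType R[i]) (N : B -> R).
Hypothesis bN : banach_norm N.
Variable D : B -> B.
Hypothesis Dlin : linear D.
Hypothesis Dmul : forall x y, D (x * y) = D x * y + x * D y.

Lemma linear_add x y : D (x + y) = D x + D y.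
Proof. by have := Dlin 1 x y; rewrite !scale1r. Qed.
Lemma linear_zero : D 0 = 0.
Proof. by apply: (addIr (D 0)); rewrite -linear_add !add0r. Qed.
Lemma linear_scale k x : D (k *: x) = k *: D x.
Proof. by have := Dlin k x 0; rewrite linear_zero !addr0. Qed.
Lemma linear_opp x : D (- x) = - D x.
Proof. by rewrite -scaleN1r linear_scale scaleN1r. Qed.
Lemma linear_sub x y : D (x - y) = D x - D y.
Proof. by rewrite linear_add linear_opp. Qed.

(** The separating space: limits of [D a] as [a] tends to 0. It measures how far the graph of [D] is
    from being closed. *)
Definition sep (b : B) : Prop := forall eps : R, 0 < eps ->
  exists a, N a < eps /\ N (D a - b) < eps.

Lemma sep0 : sep 0.
Proof. by move=> eps e0; exists 0; rewrite linear_zero subrr bnorm0. Qed.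

Lemma sepD b c : sep b -> sep c -> sep (b + c).
Proof.
move=> hb hc eps e0; have e2 : 0 < eps / 2 by lra.
have [x [x1 x2]] := hb _ e2; have [y [y1 y2]] := hc _ e2.
exists (x + y); rewrite linear_add opprD addrACA.
by split; apply: le_lt_trans (bnormD bN _ _) _; lra.
Qed.

(** When [a] tends to 0 and [D a] to [b], the Leibniz rule sends [D (c * a)] to [c * b]; hence [sep]
    is an ideal. *)
Lemma sepM b c : sep b -> sep (c * b).
Proof.
move=> hb eps e0; have k0 : 0 < N c + N (D c) + 1.
  by have := bnorm_ge0 bN c; have := bnorm_ge0 bN (D c); lra.
have [a [a1 a2]] := hb _ (divr_gt0 e0 k0).
move: a1 a2; rewrite !ltr_pdivlMr // => a1 a2.
have h0 := (bnorm_ge0 bN c, bnorm_ge0 bN (D c), bnorm_ge0 bN a, bnorm_ge0 bN (D a - b)).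
exists (c * a); split.
  by apply: le_lt_trans (bnormM bN _ _) _; move: h0 => [[[? ?] ?] ?]; nra.
have -> : D (c * a) - c * b = D c * a + c * (D a - b) by rewrite Dmul; ring.
apply: le_lt_trans (bnormD bN _ _) _.
have := bnormM bN (D c) a; have := bnormM bN c (D a - b).
move: h0 => [[[? ?] ?] ?] h1 h2.
by case: (leP (N a) (N (D a - b))) => ?; nra.
Qed.

Lemma sepZ k b : sep b -> sep (k *: b).
Proof. by rewrite -mulr_algl; exact: sepM. Qed.

Lemma sepN b : sep b -> sep (- b).
Proof. by rewrite -scaleN1r; exact: sepZ. Qed.

(** Sublevel sets of the seminorm of [D x] modulo [sep], with a witness in place of the infimum. *)
Let U (t : R) (x : B) : Prop := exists2 s, sep s & N (D x - s) <= t.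

(** Baire category: the sets [U n%:R] cover [B], since 0 is in [sep]. If none were dense in a ball,
    nested balls avoiding them one after the other would shrink to a point outside all of them. *)
Lemma sep_somewhere_dense : exists n : nat, exists x0, exists2 r : R, 0 < r &
  forall x, N (x - x0) < r ->
  forall eps, 0 < eps -> exists2 x', U n%:R x' & N (x - x') < eps.
Proof.
apply: contrapT => H.
have step (p : nat * (B * R)) : exists q : B * R, 0 < p.2.2 ->
   [/\ 0 < q.2, q.2 <= p.2.2 / 2, N (q.1 - p.2.1) + q.2 <= p.2.2 &
       forall x', U p.1%:R x' -> q.2 < N (q.1 - x')].
  case: p => n [x0 r] /=; apply: contrapT => H1; apply: H.
  exists n, x0, r; first by apply: contrapT => H2; apply: H1; exists (x0, r).
  move=> x hx eps e0; apply: contrapT => H2; apply: H1.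
  have xx : 0 <= N (x - x0) := bnorm_ge0 bN _.
  pose r1 := Num.min ((r - N (x - x0)) / 2) (eps / 2).
  have [h1 h2 h3]: [/\ r1 <= (r - N (x - x0)) / 2, r1 <= eps / 2 & 0 < r1].
    by rewrite /r1 !ge_min !lexx orbT lt_min; split=> //; apply/andP; split; lra.
  exists (x, r1) => r0 /=; split=> //; try lra.
  move=> x' hx'; rewrite ltNge; apply/negP => h4; apply: H2.
  by exists x' => //; lra.
have [f hf] := choice step.
pose st := fix st n := if n is m.+1 then f (m, st m) else (0 : B, 1 : R).
have r0 n : 0 < (st n).2.
  by elim: n => [|n IH] /=; [lra | case: (hf (n, st n) IH)].
have hst n := hf (n, st n) (r0 n).
have r2 n : (st n).2 <= 2^-1 ^+ n.
  elim: n => [|n IH]; first by rewrite expr0.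
  by have [_ /= h _ _] := hst n; rewrite exprS; lra.
have [l hl] := @geometric_cvg _ _ _ bN (fun n => (st n).1) 1 ltac:(
   move=> n; have [? _ /= h _] := hst n; have := r2 n; rewrite mul1r; lra).
have ball n k : N ((st (n + k)%N).1 - (st n).1) <= (st n).2 - (st (n + k)%N).2.
  elim: k => [|k IH]; first by rewrite addn0 !subrr (bnorm0 bN).
  rewrite addnS; apply: le_trans (bnorm_triangle bN _ (st (n + k)%N).1 _) _.
  by have [_ _ /= h _] := hst (n + k)%N; lra.
have hball n : N (l - (st n).1) <= (st n).2.
  rewrite leNgt; apply/negP => h.
  have [m hm] : exists m, 2 * 2^-1 ^+ m < N (l - (st n).1) - (st n).2.
    by apply: geometric_lt; lra.
  have := bnorm_triangle bN l (st (n + m)%N).1 (st n).1.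
  have := ball n m; have := hl (n + m)%N; rewrite (bnorm_distC bN l (st (n + m)%N).1).
  have := r0 (n + m)%N; rewrite exprD.
  have p n' : 0 <= (2^-1 : R) ^+ n' <= 1.
    by rewrite exprn_ge0 ?invr_ge0 // exprn_ile1 ?invr_ge0 // invf_le1 ?ler1n.
  by have /andP[? ?] := p n; have /andP[? ?] := p m; nra.
(* The ball of index [n.+1] contains [l] and avoids [U n%:R], where [l] lies by the choice of
   [n]. *)
pose n := (Num.truncn (N (D l))).+1.
have [_ _ _ /= /(_ l)] := hst n; have := hball n.+1; rewrite (bnorm_distC bN) /= => h1.
move=> h2; have : U n%:R l by exists 0; [exact: sep0 | rewrite subr0 ltW // truncnS_gt].
by move=> /h2; lra.
Qed.

(** Differences of points of [U n%:R] lie in [U (2 * n%:R)], so the ball of [sep_somewhere_dense]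
    can be moved to the origin and rescaled. *)
Lemma sep_dense_scaled : exists2 K : R, 0 <= K & forall w eps, 0 < eps ->
  exists2 x', U (K * N w) x' & N (w - x') < eps.
Proof.
have [n [x0 [r r0 H]]] := sep_somewhere_dense.
exists (4 * n%:R / r); first by rewrite divr_ge0 ?mulr_ge0 // ltW.
move=> w eps e0.
have [/eqP w0 | w0] := boolP (N w == 0).
  exists 0; last by rewrite subr0 w0.
  by exists 0; [exact: sep0 | rewrite linear_zero subrr (bnorm0 bN) w0 mulr0].
have wp : 0 < N w by rewrite lt_neqAle eq_sym w0 (bnorm_ge0 bN).
(* Scaled by [t], [w] has norm [r / 2]; undoing the scaling turns [2 * n%:R] into
   [4 * n%:R / r * N w]. *)
pose t := r / (2 * N w); have t0 : 0 < t by rewrite divr_gt0 // mulr_gt0.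
have te : 0 < t * eps / 2 by rewrite divr_gt0 // mulr_gt0.
have [|x1 [s1 hs1 hx1] h1] := H (x0 + t%:C *: w) _ _ te.
  rewrite addrAC subrr add0r (bnormZ_real bN) gtr0_norm // /t invfM mulrA.
  by rewrite mulfVK //; lra.
have [|x2 [s2 hs2 hx2] h2] := H x0 _ _ te; first by rewrite subrr (bnorm0 bN).
have tC : t%:C * t^-1%:C = 1 :> R[i].
  by rewrite -rmorphM /= divff ?gt_eqF.
exists (t^-1%:C *: (x1 - x2)).
  exists (t^-1%:C *: (s1 - s2)); first by apply: sepZ; apply: sepD => //; exact: sepN.
  rewrite linear_scale -scalerBr (bnormZ_real bN) linear_sub.
  rewrite gtr0_norm ?invr_gt0 //.
  have -> : D x1 - D x2 - (s1 - s2) = (D x1 - s1) - (D x2 - s2) by ring.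
  rewrite -ler_pdivlMl ?invr_gt0 // invrK.
  apply: le_trans (bnormB bN _ _) _; apply: le_trans (lerD hx1 hx2) _.
  have -> : t * (4 * n%:R / r * N w) = 2 * n%:R; last by lra.
  by rewrite /t; field; rewrite w0 gt_eqF.
have -> : w - t^-1%:C *: (x1 - x2) =
    t^-1%:C *: ((x0 + t%:C *: w - x1) - (x0 - x2)).
  rewrite !(scalerDr, scalerN) scalerA (mulrC _ t%:C) tC scale1r.
  ring.
rewrite (bnormZ_real bN) gtr0_norm ?invr_gt0 // -ltr_pdivlMl ?invr_gt0 // invrK.
by apply: le_lt_trans (bnormB bN _ _) _; lra.
Qed.

(* Closed graph theorem for the map induced by [D] into the quotient by its separating space. *)
Lemma sep_quotient_bounded : exists2 C : R, 0 <= C & forall z,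
  exists2 s, sep s & N (D z - s) <= C * N z.
Proof.
have [K K0 H] := sep_dense_scaled.
exists (2 * K); first by lra.
move=> z; have [/eqP z0 | z0] := boolP (N z == 0).
  rewrite z0 (bnorm_eq0 bN z0) mulr0; exists 0; first exact: sep0.
  by rewrite linear_zero subrr (bnorm0 bN).
have zp : 0 < N z by rewrite lt_neqAle eq_sym z0 (bnorm_ge0 bN).
have p2 n : 0 < (2^-1 : R) ^+ n by rewrite exprn_gt0 // invr_gt0.
have step (p : nat * B) : exists q : B * B,
   [/\ sep q.2, N (D q.1 - q.2) <= K * N p.2 & N (p.2 - q.1) <= N z * 2^-1 ^+ p.1.+1].
  have [x' [s hs h1] h2] := H p.2 _ (mulr_gt0 zp (p2 p.1.+1)).
  by exists (x', s); split=> //; exact: ltW.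
have [f hf] := choice step.
(* Successive approximation as in the open mapping theorem: [w n] is what remains of [z] after the
   first [n] approximants, and the bound on its norm halves at each step. *)
pose w := fix w n := if n is m.+1 then w m - (f (m, w m)).1 else z.
pose x n := (f (n, w n)).1; pose s n := (f (n, w n)).2.
have hs n : sep (s n) by case: (hf (n, w n)).
have hx n : N (D (x n) - s n) <= K * N (w n) by case: (hf (n, w n)).
have hw n : N (w n) <= N z * 2^-1 ^+ n.
  by case: n => [|n]; [rewrite expr0 mulr1 | case: (hf (n, w n))].
pose y n := \sum_(i < n) (D (x i) - s i).
have [l hl] := @geometric_cvg _ _ _ bN y (K * N z) ltac:(
  move=> n; rewrite /y big_ord_recr /= addrC addrK -mulrA;
  exact: le_trans (hx n) (ler_wpM2l K0 (hw n))).
(* [w n] tends to 0 and [D (w n)] is [D z - y n] up to an element of [sep]; correcting [w n] by a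
   small [a] puts [D z - l] in [sep]. *)
exists (D z - l); last first.
  rewrite opprB addrC subrK -(bnormN bN); have := hl 0%N.
  by rewrite /y big_ord0 sub0r expr0; lra.
move=> eps e0.
have [n hn] : exists n, (4 * (K + 1) * N z) * 2^-1 ^+ n < eps.
  by apply: geometric_lt => //; nra.
have e4 : 0 < eps / 4 by lra.
have hS : sep (\sum_(i < n) s i).
  by elim: (n) => [|m IH]; [rewrite big_ord0; exact: sep0
                           | rewrite big_ord_recr; exact: sepD].
have [a [a1 a2]] := hS _ e4.
have Dw : D (w n) = D z - y n - \sum_(i < n) s i.
  rewrite /y; elim: (n) => [|m IH]; first by rewrite !big_ord0 !subr0.
  by rewrite [w _]/= linear_sub IH !big_ord_recr /= -/(x m); ring.
exists (w n + a).
have := hw n; have := hl n; have := p2 n => q1 q2 q3.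
have q4 : 0 <= K * (N z * 2^-1 ^+ n) by rewrite mulr_ge0 // mulr_ge0 // ltW.
have q5 : 0 <= N z * 2^-1 ^+ n by rewrite mulr_ge0 // ltW.
split; first by apply: le_lt_trans (bnormD bN _ _) _; lra.
have -> : D (w n + a) - (D z - l) = (D a - \sum_(i < n) s i) - (y n - l).
  by rewrite linear_add Dw; ring.
by apply: le_lt_trans (bnormB bN _ _) _; lra.
Qed.

End Separating.

(** * Stabilisation of the multiples of the separating space *)

Section Stability.
Variables (R : realType) (B : comAlgType R[i]) (N : B -> R).
Hypothesis bN : banach_norm N.
Variable D : B -> B.
Hypothesis Dlin : linear D.
Hypothesis Dmul : forall x y, D (x * y) = D x * y + x * D y.

Local Notation sep := (sep N D).

Definition sep_cl (c b : B) : Prop := forall eps : R, 0 < eps ->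
  exists2 s, sep s & N (b - c * s) < eps.

(** If [c0 * s] keeps distance [eta] from [c1 * sep], then for small [a] with [D a] near [s],
    [c0 * D a] keeps distance [eta / 2]. Scaling by [2 * K / eta] raises this to [K], and [a] can be
    taken so small that the multiple stays below [eps]. *)
Lemma sep_cl_large_image c0 c1 s (K eps : R) : sep s -> ~ sep_cl c1 (c0 * s) ->
  0 < K -> 0 < eps ->
  exists2 x, N x < eps & forall t, sep t -> K <= N (c0 * D x + c1 * t).
Proof.
move=> hs ncl K0 e0.
have [eta h0 heta] : exists2 eta, 0 < eta &
    forall t, sep t -> eta <= N (c0 * s - c1 * t).
  apply: contrapT => H; apply: ncl => eta eta0; apply: contrapT => H1.
  apply: H; exists eta => // t ht; rewrite leNgt; apply/negP => h.
  by apply: H1; exists t.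
have [tau tau0 hK] : exists2 tau, 0 < tau & tau * (eta / 2) = K.
  exists (2 * K / eta); first by rewrite divr_gt0 // mulr_gt0.
  by field; rewrite gt_eqF.
have n0 : 0 < 2 * (N c0 + 1) by have := bnorm_ge0 bN c0; lra.
pose d := Num.min (eps / tau) (eta / (2 * (N c0 + 1))).
have d0 : 0 < d by rewrite lt_min; apply/andP; split; exact: divr_gt0.
have [a [a1 a2]] := hs _ d0.
move: a1 a2; rewrite !lt_min !ltr_pdivlMr // => /andP[a1 _] /andP[_ a2].
exists (tau%:C *: a); first by rewrite (bnormZ_real bN) gtr0_norm // mulrC.
move=> t ht; rewrite (linear_scale Dlin).
have tC : tau%:C * tau^-1%:C = 1 :> R[i] by rewrite -rmorphM /= divff ?gt_eqF.
have -> : c0 * (tau%:C *: D a) + c1 * t =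
    tau%:C *: ((c0 * s - c1 * (- tau^-1%:C *: t)) - c0 * (s - D a)).
  rewrite -!scalerAr scaleNr opprK -[in LHS](scale1r (c1 * t)) -tC -scalerA.
  rewrite -scalerDr; congr (_ *: _); ring.
rewrite (bnormZ_real bN) gtr0_norm //.
rewrite -[X in X <= _]hK ler_pM2l //.
have := heta _ (sepZ bN Dmul (- tau^-1%:C) ht).
have := bnormB bN (c0 * s - c1 * (- tau^-1%:C *: t) - c0 * (s - D a)) (- (c0 * (s - D a))).
rewrite opprK subrK (bnormN bN).
have := bnormM bN c0 (s - D a); rewrite (bnorm_distC bN s) in a2 *.
by have := bnorm_ge0 bN (D a - s); have := bnorm_ge0 bN c0; nra.
Qed.

(* Gliding hump. *)
Lemma sep_stable (b c : nat -> B) : (forall n, c n.+1 = c n * b n) ->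
  ~ (forall n, exists2 s, sep s & ~ sep_cl (c n.+1) (c n * s)).
Proof.
move=> hc H; have [C C0 HC] := sep_quotient_bounded bN Dlin Dmul.
(* The weights [W] are chosen to keep the error terms of the final estimate at most 1; [V] collects
   their products and [P] bounds the products of the [b m]. *)
pose W n := 1 + C * N (c n) + N (D (c n)).
have W1 n : 1 <= W n.
  have := bnorm_ge0 bN (c n); have := bnorm_ge0 bN (D (c n)) => *.
  by rewrite /W -addrA lerDl addr_ge0 // mulr_ge0.
pose V := fix V n := if n is m.+1 then V m * W n else W 0%N.
pose P := fix P n := if n is m.+1 then P m * Num.max 1 (N (b m)) else 1 : R.
have P1 n : 1 <= P n.
  elim: n => [|n IH] //=; apply: (le_trans IH); rewrite ler_peMr ?le_max ?lexx //.
  by lra.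
have V1 n : 1 <= V n.
  elim: n => [|n IH] /=; first exact: W1.
  by apply: (le_trans IH); rewrite ler_peMr //; lra.
have VW m k : W m <= V (m + k)%N.
  elim: k => [|k IH].
    rewrite addn0; case: m => [|m] //=; rewrite ler_peMl // ; have := W1 m.+1; lra.
  rewrite addnS /=; apply: (le_trans IH); rewrite ler_peMr //.
  by have := V1 (m + k)%N; lra.
have p2 n : 0 < (2^-1 : R) ^+ n by rewrite exprn_gt0 // invr_gt0.
(* The required size pays for the earlier humps and for two errors of norm at most 1, and still
   leaves [p.1%:R]. *)
have step (p : nat * B) : exists x, P p.1 * V p.1 * N x <= 2^-1 ^+ p.1.+1 /\
    forall t, sep t ->
      p.1%:R + N (D p.2) + 2 <= N (c p.1 * D x + c p.1.+1 * t).
  case: p => n X /=; have [s hs ncl] := H n.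
  have PV : 0 < P n * V n by have := P1 n; have := V1 n; nra.
  have [|x hx hK] := @sep_cl_large_image _ _ _ (n%:R + N (D X) + 2)
     _ hs ncl _ (divr_gt0 (p2 n.+1) PV).
    by have := bnorm_ge0 bN (D X); have := ler0n R n; lra.
  by exists x; split=> //; rewrite mulrC -ler_pdivlMr // ltW.
have [f hf] := choice step.
pose X := fix X n := if n is m.+1 then X m + c m * f (m, X m) else 0.
pose x n := f (n, X n).
have hx n : P n * V n * N (x n) <= 2^-1 ^+ n.+1 by case: (hf (n, X n)).
have hK n t : sep t -> n%:R + N (D (X n)) + 2 <= N (c n * D (x n) + c n.+1 * t).
  by case: (hf (n, X n)) => _; apply.
(* [T m k] is a partial sum of [x m + b m * x m.+1 + b m * b m.+1 * x m.+2 + ...] and [I m k] is its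
   term of index [k]. *)
pose T := fix T m k := if k is j.+1 then x m + b m * T m.+1 j else 0.
pose I := fix I m k := if k is j.+1 then b m * I m.+1 j else x m.
have TI m k : T m k.+1 - T m k = I m k.
  elim: k m => [|k IH] m; first by rewrite /= mulr0 addr0 subr0.
  by rewrite [T m k.+2]/= [T m k.+1]/= [I _ _]/= -IH /=; ring.
have PI m k : P m * N (I m k) <= P (m + k)%N * N (x (m + k)%N).
  elim: k m => [|k IH] m; first by rewrite addn0.
  rewrite addnS -addSn; apply: le_trans (IH m.+1) => /=.
  rewrite -mulrA ler_wpM2l //; first by have := P1 m; lra.
  apply: le_trans (bnormM bN _ _) _; rewrite ler_wpM2r ?(bnorm_ge0 bN) //.
  by rewrite le_max lexx orbT.
have WI m k : N (I m k) <= (2 * W m)^-1 * 2^-1 ^+ k.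
  rewrite -(ler_pM2l (_ : 0 < 2 * W m)); last by have := W1 m; lra.
  rewrite mulVKf; last by rewrite gt_eqF //; have := W1 m; lra.
  have : W m * N (I m k) <= V (m + k)%N * (P (m + k)%N * N (x (m + k)%N)).
    apply: ler_pM => //; [by have := W1 m; lra | exact: (bnorm_ge0 bN) |].
    apply: le_trans (PI m k); rewrite ler_peMl //; exact: (bnorm_ge0 bN).
  rewrite mulrA (mulrC (V _)) => h.
  have := le_trans h (hx _).
  have : (2^-1 : R) ^+ (m + k).+1 <= 2^-1 * 2^-1 ^+ k.
    rewrite exprS ler_wpM2l ?invr_ge0 // exprD ler_piMl ?(ltW (p2 _)) //.
    by rewrite exprn_ile1 ?invr_ge0 // invf_le1 ?ler1n.
  by lra.
have [y hy] : exists y : nat -> B, forall m k,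
    N (T m k - y m) <= 2 * (2 * W m)^-1 * 2^-1 ^+ k.
  have lim m : exists ym, forall k, N (T m k - ym) <= 2 * (2 * W m)^-1 * 2^-1 ^+ k.
    by apply: (@geometric_cvg _ _ _ bN (T m)) => k; rewrite TI.
  by have [y hy] := choice lim; exists y.
have Wy m : W m * N (y m) <= 1.
  have := hy m 0%N; rewrite /= sub0r (bnormN bN) expr0 mulr1 invfM mulrA.
  rewrite divff // mul1r => h; rewrite -ler_pdivlMl ?mulr1 //.
  by have := W1 m; lra.
have yrec m : y m = x m + b m * y m.+1.
  apply/eqP; rewrite -subr_eq0; apply/eqP; apply: (bnorm_small_eq0 bN) => eps e0.
  have w0 n : 0 < (2 * W n)^-1 by rewrite invr_gt0; have := W1 n; lra.
  have [k hk] : exists k, (2 * (2 * W m)^-1 + N (b m) * (2 * (2 * W m.+1)^-1))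
      * 2^-1 ^+ k < eps.
    apply: geometric_lt => //.
    by have := w0 m; have := w0 m.+1; have := bnorm_ge0 bN (b m); nra.
  have -> : y m - (x m + b m * y m.+1) =
    b m * (T m.+1 k - y m.+1) - (T m k.+1 - y m) by rewrite /=; ring.
  apply: le_lt_trans hk; apply: le_trans (bnormB bN _ _) _.
  rewrite addrC mulrDl lerD //.
    apply: le_trans (hy m k.+1) _; rewrite ler_wpM2l //.
      by have := w0 m; lra.
    by rewrite exprS; have := p2 k; lra.
  apply: le_trans (bnormM bN _ _) _; rewrite -mulrA ler_wpM2l //.
  exact: (bnorm_ge0 bN).
have yX n : c 0%N * y 0%N = X n + c n * y n.
  elim: n => [|n IH]; first by rewrite add0r.
  by rewrite IH yrec hc /= -/(x n); ring.
(* The hump of index [n] forces [n%:R <= N (D (c 0%N * y 0%N))], which this choice of [n]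
   excludes. *)
pose n := (Num.truncn (N (D (c 0%N * y 0%N)))).+1.
have hn : N (D (c 0%N * y 0%N)) < n%:R by exact: truncnS_gt.
have [s hs hDs] := HC (y n.+1).
have := hK n _ hs.
have -> : c n * D (x n) + c n.+1 * s = D (c 0%N * y 0%N) - D (X n)
   - (D (c n) * x n + (D (c n.+1) * y n.+1 + c n.+1 * (D (y n.+1) - s))).
  rewrite (yX n.+1) [X n.+1]/= -/(x n) !(linear_add Dlin) !Dmul; ring.
have h1 : N (D (c n) * x n) <= 1.
  apply: le_trans (bnormM bN _ _) _.
  have : W n * N (x n) <= P n * V n * N (x n).
    rewrite ler_wpM2r ?(bnorm_ge0 bN) //.
    have := VW n 0%N; rewrite addn0; have := P1 n; have := W1 n; nra.
  have : (2^-1 : R) ^+ n.+1 <= 1.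
    by rewrite exprn_ile1 ?invr_ge0 // invf_le1 ?ler1n.
  have := hx n.
  have : N (D (c n)) * N (x n) <= W n * N (x n).
    rewrite ler_wpM2r ?(bnorm_ge0 bN) // /W lerDr addr_ge0 // mulr_ge0 //.
    exact: (bnorm_ge0 bN).
  by lra.
have h2 : N (D (c n.+1) * y n.+1 + c n.+1 * (D (y n.+1) - s)) <= 1.
  apply: le_trans (bnormD bN _ _) _; apply: le_trans (Wy n.+1).
  rewrite /W; have := bnormM bN (D (c n.+1)) (y n.+1).
  have := bnormM bN (c n.+1) (D (y n.+1) - s).
  have : N (c n.+1) * N (D (y n.+1) - s) <= N (c n.+1) * (C * N (y n.+1)).
    by rewrite ler_wpM2l ?(bnorm_ge0 bN).
  by have := bnorm_ge0 bN (y n.+1); lra.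
have := bnormB bN (D (c 0%N * y 0%N) - D (X n))
   (D (c n) * x n + (D (c n.+1) * y n.+1 + c n.+1 * (D (y n.+1) - s))).
have := bnormB bN (D (c 0%N * y 0%N)) (D (X n)).
have := bnormD bN (D (c n) * x n) (D (c n.+1) * y n.+1 + c n.+1 * (D (y n.+1) - s)).
by lra.
Qed.

(** If there were no such [a], dependent choice starting at 1 would give multiples [c n] with
    [c n * sep] never inside the closure of [c n.+1 * sep], against [sep_stable]. *)
Lemma sep_minimal_multiple : (exists2 s, sep s & s != 0) ->
  exists2 a, (exists2 s, sep s & a * s != 0) &
  forall b, (forall s, sep s -> a * b * s = 0) \/
            (forall s, sep s -> sep_cl (a * b) (a * s)).
Proof.
move=> [s0 hs0 s00]; apply: contrapT => H.
have step a : exists b, (exists2 s, sep s & a * s != 0) ->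
    (exists2 s, sep s & a * b * s != 0) /\
    (exists2 s, sep s & ~ sep_cl (a * b) (a * s)).
  apply: contrapT => H1; apply: H; exists a.
    apply: contrapT => H2; apply: H1; exists 1 => /H2 [].
  move=> b; apply: contrapT => H2; apply: H1; exists b => _; split.
    apply: contrapT => H3; apply: H2; left => s hs.
    by apply/eqP/negPn/negP => h; apply: H3; exists s.
  apply: contrapT => H3; apply: H2; right => s hs.
  by apply: contrapT => h; apply: H3; exists s.
have [f hf] := choice step.
pose c := fix c n := if n is m.+1 then c m * f (c m) else 1.
have hc n : exists2 s, sep s & c n * s != 0.
  elim: n => [|n IH]; first by exists s0; rewrite // mul1r.
  by case: (hf _ IH).
apply: (@sep_stable (fun n => f (c n)) c) => // n.
by case: (hf _ (hc n)).
Qed.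

End Stability.

(** * The Gelfand-Mazur theorem *)

Section GelfandMazur.
Variables (R : realType).

Lemma normc_le_sum (a b : R) : normc (a +i* b) <= `|a| + `|b|.
Proof.
rewrite /= -[leRHS]ger0_norm ?addr_ge0 // -sqrtr_sqr ler_wsqrtr //.
rewrite sqrrD !real_normK ?num_real // lerD2r lerDl.
by rewrite mulrn_wge0 // mulr_ge0.
Qed.

Lemma normc_ge_re_im (z : R[i]) : `|complex.Re z| <= normc z /\ `|complex.Im z| <= normc z.
Proof.
case: z => a b /=; split; rewrite -sqrtr_sqr ler_wsqrtr //.
  by rewrite lerDl sqr_ge0.
by rewrite lerDr sqr_ge0.
Qed.

Lemma normc_ge0 (z : R[i]) : 0 <= normc z.
Proof. by case: z => a b; exact: sqrtr_ge0. Qed.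

Lemma locally_bounded_square (f : R[i] -> R) :
  (forall z, exists C, exists2 d, 0 < d &
     forall w, normc (w - z) < d -> f w <= C) ->
  forall L, exists C, forall z, `|complex.Re z| <= L -> `|complex.Im z| <= L -> f z <= C.
Proof.
move=> H L.
pose K : set (R * R) := (`[- L, L] `*` `[- L, L])%classic.
have cK : compact K by apply: compact_setX; exact: segment_compact.
have /compact_near_coveringP /(_ R (+oo%R) (fun M x => f (x.1 +i* x.2) <= M) _) := cK.
case.
  move=> [a b] _; have [C [d d0 Cd]] := H (a +i* b).
  exists (ball (a, b) (d / 2), [set M | C <= M]%classic).
    split=> /=; first by apply: nbhsx_ballx; rewrite divr_gt0.
    by apply: nbhs_pinfty_ge; exact: num_real.
  move=> [[x y] M] /= [[/= h1 h2] hM]; move: h1 h2; rewrite /ball /= => h1 h2.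
  have : f (x +i* y) <= C; last by move: hM; lra.
  apply: Cd; apply: le_lt_trans (normc_le_sum (x - a) (y - b)) _.
  by rewrite (distrC x) (distrC y); lra.
move=> M [_ hM]; exists (M + 1) => -[a b] /= ha hb.
apply: (hM (M + 1) _ (a, b)); first by lra.
by split; rewrite /= in_itv /= -ler_norml.
Qed.

Variables (B : comAlgType R[i]) (N : B -> R).
Hypothesis bN : banach_norm N.

Section Idempotent.
Variables (p x : B).
Hypotheses (pp : p * p = p) (p0 : p != 0) (px : p * x = x).

Let Np_ge1 : 1 <= N p.
Proof.
have h : 0 < N p.
  rewrite lt_neqAle (bnorm_ge0 bN) andbT eq_sym; apply/eqP => /(bnorm_eq0 bN) /eqP.
  by rewrite (negbTE p0).
by have := bnormM bN p p; rewrite pp; nra.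
Qed.

Section Resolvent.
Variable r : R[i] -> B.
Hypotheses (pr : forall l, p * r l = r l)
  (hr : forall l, (l *: p - x) * r l = p).

Lemma resolventB l m : r l - r m = (m - l) *: (r l * r m).
Proof.
have h1 : r l = r l * ((m *: p - x) * r m) by rewrite hr mulrC pr.
have h2 : r m = r l * ((l *: p - x) * r m).
  by rewrite mulrCA mulrA hr pr.
rewrite {1}h1 {2}h2 -mulrBr -mulrBl.
have -> : m *: p - x - (l *: p - x) = (m - l) *: p by rewrite scalerBl; ring.
by rewrite -scalerAl -scalerAr pr.
Qed.

Lemma resolventZ l : l *: r l = p + x * r l.
Proof.
by apply/eqP; rewrite -subr_eq -(hr l) mulrBl -scalerAl pr.
Qed.

(** Outside a square of half-side [N x + 1], [resolventZ] gives [N (r l) <= N p]. Inside it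
    compactness applies, as the resolvent identity gives [N (r m) <= 2 * N (r l)] for [m] near
    [l]. *)
Lemma resolvent_bounded : exists2 C, 0 <= C & forall l, N (r l) <= C.
Proof.
have [|C HC] := @locally_bounded_square (fun l => N (r l)) _ (N x + 1).
  move=> l; exists (2 * N (r l)).
  have n0 : 0 < 2 * N (r l) + 1 by have := bnorm_ge0 bN (r l); lra.
  exists (2 * N (r l) + 1)^-1; first by rewrite invr_gt0.
  move=> m; rewrite -[_^-1]mul1r ltr_pdivlMr // => hm.
  have := bnorm_triangle bN (r m) (r l) 0; rewrite !subr0 resolventB (bnormZ bN).
  rewrite -normcN opprB.
  have := bnormM bN (r m) (r l); have := normc_ge0 (m - l).
  have := bnorm_ge0 bN (r m); have := bnorm_ge0 bN (r l).
  move=> h1 h2 h3 h4 h5.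
  have h6 : normc (m - l) * N (r m * r l) <= normc (m - l) * (N (r m) * N (r l)).
    by rewrite ler_wpM2l.
  have h7 : normc (m - l) * N (r l) <= 2^-1 by nra.
  have : normc (m - l) * N (r l) * N (r m) <= 2^-1 * N (r m) by rewrite ler_wpM2r.
  by lra.
exists (Num.max C (N p)); first by rewrite le_max (bnorm_ge0 bN) orbT.
move=> l; rewrite le_max.
case: (leP `|complex.Re l| (N x + 1)) => hre; last first.
  apply/orP; right; have [h _] := normc_ge_re_im l.
  have := bnormD bN p (x * r l); rewrite -resolventZ (bnormZ bN).
  by have := bnormM bN x (r l); have := bnorm_ge0 bN (r l); nra.
case: (leP `|complex.Im l| (N x + 1)) => him; last first.
  apply/orP; right; have [_ h] := normc_ge_re_im l.
  have := bnormD bN p (x * r l); rewrite -resolventZ (bnormZ bN).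
  by have := bnormM bN x (r l); have := bnorm_ge0 bN (r l); nra.
by rewrite HC.
Qed.

Let Y := fix Y k := if k is j.+1 then Y j * Y j else x.

Let pY k : p * Y k = Y k.
Proof. by elim: k => [|k IH] //=; rewrite mulrA IH. Qed.

(* [g k mu = mu (mu - x^(2^k))^-1], and [g k.+1 (mu^2)] is the average of [g k] over [mu] and
   [- mu], so the bounds on the circles [|mu| = rho] do not deteriorate with [k]. *)
Lemma resolvent_averages C : 0 <= C -> (forall l, N (r l) <= C) ->
  forall k, exists g : R[i] -> B,
  [/\ forall m, p * g m = g m,
      forall m, (m *: p - Y k) * g m = m *: p,
      forall z rho rho', normc z = 1 ->
        N (g ((rho ^+ (2 ^ k))%:C * z) - g ((rho' ^+ (2 ^ k))%:C * z))
          <= N x * C ^+ 2 * `|rho - rho'|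
    & forall z rho, normc z = 1 -> 0 <= rho -> N (g ((rho ^+ (2 ^ k))%:C * z)) <= C * rho].
Proof.
move=> C0 HC; elim=> [|k [g [pg hg gL gC]]].
  exists (fun m => m *: r m); split.
  - by move=> m; rewrite -scalerAr pr.
  - by move=> m; rewrite -scalerAr hr.
  - move=> z rho rho' hz; rewrite !expr1 !resolventZ.
    set l := _ * z; set m := _ * z.
    have -> : p + x * r l - (p + x * r m) = x * (r l - r m) by ring.
    rewrite resolventB.
    apply: le_trans (bnormM bN _ _) _; rewrite -mulrA ler_wpM2l ?(bnorm_ge0 bN) //.
    have -> : m - l = (rho' - rho)%:C * z by rewrite rmorphB /= mulrBl.
    rewrite (bnormZ bN) normcM hz mulr1 normc_real distrC mulrC ler_wpM2r //.
    by apply: le_trans (bnormM bN _ _) _; rewrite expr2 ler_pM ?(bnorm_ge0 bN).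
  - move=> z rho hz rho0; rewrite expr1 (bnormZ bN) normcM hz mulr1 normc_real.
    by rewrite ger0_norm // mulrC ler_wpM2r.
have two : (2^-1 : R)%:C + (2^-1)%:C = 1 :> R[i].
  by rewrite -rmorphD /= -[RHS]/(1%:C); congr (_%:C); lra.
have half_norm : `|2^-1 : R| = 2^-1 by rewrite ger0_norm ?invr_ge0.
pose h m := (2^-1 : R)%:C *: (g m + g (- m)).
(* The roots chosen by [sqrtc] are only determined up to sign, which [h], being even, does not
   see. *)
have hE z (rho : R) : normc z = 1 -> exists2 y, normc y = 1 & forall rho : R,
    h (sqrtc ((rho ^+ (2 ^ k.+1))%:C * z)) = h ((rho ^+ (2 ^ k))%:C * y).
  move=> hz; exists (sqrtc z).
    have : normc (sqrtc z) * normc (sqrtc z) = 1.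
      by rewrite -normcM -expr2 sqr_sqrtc.
    by have := normc_ge0 (sqrtc z); nra.
  move=> rho1; set m := sqrtc _; set l := _ * _.
  have : m ^+ 2 == l ^+ 2.
    by rewrite /m /l exprMn !sqr_sqrtc -rmorphXn /= -exprM expnSr.
  rewrite eqf_sqr => /orP[/eqP -> // | /eqP ->].
  by rewrite /h opprK addrC.
exists (fun m => h (sqrtc m)); split.
- by move=> m; rewrite /h -scalerAr mulrDr !pg.
- move=> m; rewrite /h; set l := sqrtc m.
  have lm : m = l * l by rewrite -expr2 sqr_sqrtc.
  have h1 := hg l; have h2 := hg (- l).
  have h3 : (l *: p + Y k) * g (- l) = l *: p.
    by apply: oppr_inj; rewrite -mulNr opprD -!scaleNr; exact: h2.
  have ll : (l *: p) * (l *: p) = m *: p by rewrite -scalerAl -scalerAr pp scalerA lm.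
  have -> : m *: p - Y k.+1 = (l *: p - Y k) * (l *: p + Y k) by rewrite -ll /=; ring.
  rewrite -scalerAr mulrDr (mulrAC _ _ (g l)) h1 -mulrA h3.
  have -> : l *: p * (l *: p + Y k) + (l *: p - Y k) * (l *: p) =
    (l *: p) * (l *: p) + (l *: p) * (l *: p) by ring.
  by rewrite ll scalerDr -scalerDl two scale1r.
- move=> z rho rho' hz; have [y hy yE] := hE z rho hz.
  rewrite !yE /h -scalerBr (bnormZ_real bN).
  have -> u v u' v' : (u + v) - (u' + v') = (u - u') + (v - v') :> B by ring.
  rewrite -!mulrN.
  have := gL y rho rho' hy; have := gL (- y) rho rho' ltac:(by rewrite normcN).
  rewrite half_norm => h1 h2.
  have := bnormD bN (g ((rho ^+ (2 ^ k))%:C * y) - g ((rho' ^+ (2 ^ k))%:C * y))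
   (g ((rho ^+ (2 ^ k))%:C * - y) - g ((rho' ^+ (2 ^ k))%:C * - y)).
  by lra.
- move=> z rho hz rho0; have [y hy yE] := hE z rho hz.
  rewrite !yE /h (bnormZ_real bN) -!mulrN.
  have := gC y rho hy rho0; have := gC (- y) rho ltac:(by rewrite normcN) rho0.
  rewrite half_norm => h1 h2.
  have := bnormD bN (g ((rho ^+ (2 ^ k))%:C * y)) (g ((rho ^+ (2 ^ k))%:C * - y)).
  by lra.
Qed.

Let tau := (10 * N p)^-1.
(** A certificate, read off one power of [x], that the spectral radius of [x] is at most [rho]. *)
Let E (rho : R) := exists k, N (Y k) <= tau * rho ^+ (2 ^ k).

(** In place of Liouville's theorem: the Lipschitz bound of [resolvent_averages] does not depend on
    [k], so [E rho] can be pushed down in steps of fixed length until [C * rho < 2^-1], where [g]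
    would be both small and close to [p]. *)
Lemma resolvent_absurd : False.
Proof.
have [C C0 HC] := resolvent_bounded.
have G := resolvent_averages C0 HC.
have Np := Np_ge1.
have tau0 : 0 < tau by rewrite invr_gt0; lra.
have tauN : tau * N p = 10^-1.
  by rewrite /tau invfM -mulrA mulVf ?mulr1 // gt_eqF //; lra.
have tau1 : tau <= 10^-1 by nra.
have NY k : N (Y k.+1) <= N (Y k) ^+ 2 by rewrite expr2; exact: (bnormM bN).
have near1 a k g : 0 < a -> (a%:C *: p - Y k) * g = a%:C *: p -> p * g = g ->
    forall t, N (Y k) <= t * a -> N (g - p) <= t * N g.
  move=> a0 hg pg t ht.
  have : a%:C *: (g - p) = Y k * g.
    rewrite scalerBr -hg mulrBl -scalerAl pg; ring.
  move=> /(congr1 N); rewrite (bnormZ_real bN) gtr0_norm // => h.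
  have := bnormM bN (Y k) g; rewrite -h => h1.
  have : a * N (g - p) <= a * (t * N g); last by rewrite ler_pM2l.
  apply: le_trans h1 _; rewrite mulrA (mulrC a) ler_wpM2r //.
  exact: (bnorm_ge0 bN).
(* Passing to [k.+1] squares [tau], so [g] at [rho] is within [tau / 9] of [p]; the Lipschitz bound
   adds [tau / 4] at [rho']. Solving [Y k.+1 * g1 = a'%:C *: (g1 - p)] for [Y k.+1] then bounds
   it. *)
have stepE rho rho' : E rho -> 0 < rho -> 0 < rho' ->
    N x * C ^+ 2 * `|rho' - rho| <= tau / 4 -> E rho'.
  move=> [k hk] rho0 rho0' hd; exists k.+1.
  have a0 : 0 < rho ^+ (2 ^ k.+1) by rewrite exprn_gt0.
  have a0' : 0 < rho' ^+ (2 ^ k.+1) by rewrite exprn_gt0.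
  have hk1 : N (Y k.+1) <= tau ^+ 2 * rho ^+ (2 ^ k.+1).
    apply: le_trans (NY k) _; rewrite expnSr exprM -exprMn.
    by rewrite lerXn2r ?nnegrE ?(bnorm_ge0 bN) // mulr_ge0 ?ltW // exprn_gt0.
  have [g [pg hg gL _]] := G k.+1.
  have n1 : normc (1 : R[i]) = 1 by exact: normc1.
  have := gL _ rho' rho n1; rewrite !mulr1 => h1.
  have h2 := near1 _ _ _ a0 (hg _) (pg _) _ hk1.
  have := hg (rho' ^+ (2 ^ k.+1))%:C; have := pg (rho' ^+ (2 ^ k.+1))%:C.
  move: h1 h2; set g1 := g _; set g2 := g _; set a' := rho' ^+ _ in a0' *.
  move=> h1 h2 pg1 hg1.
  have h3 := bnormD bN p (g2 - p); rewrite addrC subrK in h3.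
  have h4 : N (g2 - p) <= tau / 9.
    have : tau ^+ 2 <= 10^-1 * tau by nra.
    have : tau ^+ 2 * N p <= 10^-1 * tau by nra.
    have := bnorm_ge0 bN (g2 - p) => *; nra.
  have h5 : N (g1 - p) <= 37 / 100 * tau.
    by have := bnorm_triangle bN g1 g2 p; lra.
  have h6 : Y k.+1 = a'%:C *: (g1 - p) - Y k.+1 * (g1 - p).
    have -> : a'%:C *: (g1 - p) = Y k.+1 * g1.
      rewrite scalerBr -hg1 mulrBl -scalerAl pg1; ring.
    by rewrite -mulrBr opprB addrC subrK mulrC pY.
  have : N (Y k.+1) <= a' * N (g1 - p) + N (Y k.+1) * N (g1 - p).
    rewrite {1}h6; apply: le_trans (bnormB bN _ _) _.
    by rewrite (bnormZ_real bN) gtr0_norm // lerD2l (bnormM bN).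
  have := bnorm_ge0 bN (Y k.+1) => h7 h8.
  have h9 : a' * N (g1 - p) <= a' * (37 / 100 * tau) by rewrite ler_pM2l.
  have h10 : N (Y k.+1) * N (g1 - p) <= N (Y k.+1) * (37 / 1000).
    by rewrite ler_wpM2l //; lra.
  by nra.
(* Here [N g1 < 1/2] and [N (g1 - p) <= 1/20], contrary to [1 <= N p]. *)
have stop rho : E rho -> 0 < rho -> C * rho < 2^-1 -> False.
  move=> [k hk] rho0 hC.
  have a0 : 0 < rho ^+ (2 ^ k) by rewrite exprn_gt0.
  have [g [pg hg _ gC]] := G k.
  have := gC 1 rho (normc1 _) (ltW rho0); rewrite mulr1.
  have := near1 _ _ _ a0 (hg _) (pg _) _ hk.
  set g1 := g _ => h1 h2.
  have := bnormB bN g1 (g1 - p); rewrite opprB addrC subrK => h3.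
  have := bnorm_ge0 bN g1 => h4.
  have : tau * N g1 <= 10^-1 * 2^-1 by nra.
  by lra.
pose L := N x * C ^+ 2.
have L0 : 0 <= L by rewrite mulr_ge0 ?(bnorm_ge0 bN) // sqr_ge0.
pose dl := tau / (4 * (L + 1)).
have dl0 : 0 < dl by rewrite divr_gt0 //; lra.
have dlL : L * dl <= tau / 4.
  rewrite /dl mulrA ler_pdivrMr; last by lra.
  by nra.
pose rs := (4 * (C + 1))^-1.
have rs0 : 0 < rs by rewrite invr_gt0; lra.
have Crs : C * rs < 2^-1.
  by rewrite /rs -ltr_pdivlMr ?invr_gt0 ?invrK; lra.
(* [E r0] holds with [k = 0]; the radii [rn n] descend from there by [dl] and stop at [rs]. *)
pose r0 := N x / tau.
pose rn n := Num.max (r0 - n%:R * dl) rs.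
have rn0 n : 0 < rn n by rewrite lt_max rs0 orbT.
have En n : E (rn n).
  elim: n => [|n IH].
    exists 0%N; rewrite expr1 [N _]/=; have : r0 <= rn 0%N.
      by rewrite le_max mul0r subr0 lexx.
    rewrite -(ler_pM2l tau0); apply: le_trans.
    by rewrite /r0 mulrC mulfVK ?gt_eqF.
  apply: (stepE _ _ IH) => //; apply: le_trans dlL; rewrite ler_wpM2l //.
  rewrite /rn -natr1 ler_norml; apply/andP.
  by split; case: (leP (r0 - n%:R * dl) rs) => ?;
    case: (leP (r0 - (n%:R + 1) * dl) rs) => ?; lra.
have [n hn] : exists n : nat, r0 / dl < n%:R.
  by exists (Num.truncn (r0 / dl)).+1; exact: truncnS_gt.
apply: (stop (rn n)) => //.
suff -> : rn n = rs by [].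
rewrite /rn; apply/max_idPr; move: hn; rewrite ltr_pdivrMr //; lra.
Qed.

End Resolvent.

Lemma exists_spectral_value : exists l : R[i], ~ exists w, (l *: p - x) * w = p.
Proof.
apply: contrapT => H.
have H1 l : exists w, (l *: p - x) * w = p.
  by apply: contrapT => h; apply: H; exists l.
have [w hw] := choice H1.
apply: (@resolvent_absurd (fun l => p * w l)) => l; first by rewrite mulrA pp.
by rewrite mulrCA hw pp.
Qed.

End Idempotent.
End GelfandMazur.

(** * Derivations of semisimple commutative Banach algebras *)

Section BoundedDerivation.
Variables (R : realType) (B : comAlgType R[i]) (N : B -> R).
Hypothesis bN : banach_norm N.
Variable D : B -> B.
Hypothesis Dlin : linear D.
Hypothesis Dmul : forall x y, D (x * y) = D x * y + x * D y.

Let ad (a : B) (T : B -> B) (x : B) : B := T (a * x) - a * T x.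

(** [ad a D] is multiplication by [D a], which [ad a] kills, so only two terms remain in the Leibniz
    rule for [D \o T]. *)
Lemma iter_ad_comp a T m x : iter m.+1 (ad a) (D \o T) x =
  D (iter m.+1 (ad a) T x) + m.+1%:R * (D a * iter m (ad a) T x).
Proof.
elim: m x => [|m IH] x.
  by rewrite /= /ad /= (linear_sub Dlin) Dmul; ring.
rewrite iterS {1}/ad !IH.
have -> : iter m.+2 (ad a) T x =
    iter m.+1 (ad a) T (a * x) - a * iter m.+1 (ad a) T x by [].
have e : iter m (ad a) T (a * x) = iter m.+1 (ad a) T x + a * iter m (ad a) T x.
  by rewrite iterS {2}/ad subrK.
rewrite e; move: (iter m.+1 _ _ _) (iter m.+1 _ _ (a * x)) => g g'.
rewrite (linear_sub Dlin) Dmul -[m.+2%:R]natr1; ring.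
Qed.

(** By induction the [n]-fold commutator is a multiplication operator, so one more [ad a] kills it
    and the second term of [iter_ad_comp] alone survives. *)
Lemma iter_ad_iter a n x :
  iter n (ad a) (iter n (comp D) id) x = n`!%:R * D a ^+ n * x.
Proof.
elim: n x => [|n IH] x; first by rewrite fact0 expr0 !mul1r.
have e : iter n.+1 (ad a) (iter n (comp D) id) x = 0.
  pose F := iter n (ad a) (iter n (comp D) id).
  by transitivity (F (a * x) - a * F x); rewrite // /F !IH; ring.
have -> : iter n.+1 (comp D) id = D \o iter n (comp D) id by [].
by rewrite iter_ad_comp e IH (linear_zero Dlin) factS natrM exprS; ring.
Qed.

(* Kleinecke-Shirokov: [n! (D a)^n] is an [n]-fold commutator of [D^n] with multiplication by [a]. *)
Lemma bounded_derivation_invertible C a : (forall z, N (D z) <= C * N z) -> invertible (1 - D a).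
Proof.
move=> HC.
have C0 : 0 <= C.
  by have := HC 1; have := bnorm_ge0 bN (D 1); have := bnorm1_gt0 bN; nra.
have HDn n x : N (iter n (comp D) id x) <= C ^+ n * N x.
  elim: n => [|n IH]; first by rewrite expr0 mul1r.
  by apply: le_trans (HC _) _; rewrite exprS -mulrA ler_wpM2l.
have Had T c m : (forall x, N (T x) <= c * N x) ->
    forall x, N (iter m (ad a) T x) <= (2 * N a) ^+ m * c * N x.
  move=> hT; elim: m => [|m IH] x; first by rewrite expr0 mul1r.
  have c0 : 0 <= (2 * N a) ^+ m * c.
    have := hT 1; have := bnorm_ge0 bN (T 1); have := bnorm1_gt0 bN => ? ? ?.
    by rewrite mulr_ge0 ?exprn_ge0 ?mulr_ge0 ?(bnorm_ge0 bN) //; nra.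
  rewrite iterS {1}/ad; apply: le_trans (bnormB bN _ _) _.
  have h1 := le_trans (IH (a * x)) (ler_wpM2l c0 (bnormM bN a x)).
  have h2 := le_trans (bnormM bN a (iter m (ad a) T x)) (ler_wpM2l (bnorm_ge0 bN a) (IH x)).
  apply: le_trans (lerD h1 h2) _; rewrite exprS.
  by rewrite le_eqVlt; apply/orP; left; apply/eqP; ring.
have [n hn] : exists n, exp_coeff (2 * N a * C) n * N 1 <= 2^-1.
  have N1 := bnorm1_gt0 bN.
  have := cvg_exp_coeff (2 * N a * C) => /cvgrPdist_lt /(_ (2^-1 / N 1)).
  case; first by rewrite divr_gt0.
  move=> n _ /(_ n (leqnn n)); rewrite sub0r normrN => h; exists n.
  rewrite -ler_pdivlMr //; apply: ltW; apply: le_lt_trans h.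
  exact: ler_norm.
have hq : N (D a ^+ n) <= 2^-1.
  apply: le_trans hn; rewrite /exp_coeff /=.
  have := Had _ _ n (HDn n) 1; rewrite iter_ad_iter mulr1 -exprMn.
  rewrite mulr_natl -scaler_nat -(rmorph_nat (real_complex R)) (bnormZ_real bN) ger0_norm //.
  by move=> h; rewrite mulrAC ler_pdivlMr ?ltr0n ?fact_gt0 // mulrC.
have [v hv] := neumann_invertible bN hq.
(* [1 - D a] divides the invertible [1 - D a ^+ n]. *)
exists ((\sum_(i < n) D a ^+ i) * v).
by rewrite mulrA -[RHS]hv; congr (_ * v); rewrite -[RHS]opprB subrX1 -mulNr opprB.
Qed.

End BoundedDerivation.

Section Johnson.
Variables (R : realType) (B : comAlgType R[i]) (N : B -> R).
Hypothesis bN : banach_norm N.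
Hypothesis semisimpleB : semisimple_alg B.
Variable D : B -> B.
Hypothesis Dlin : linear D.
Hypothesis Dmul : forall x y, D (x * y) = D x * y + x * D y.

(* A minimal nonzero multiple of the separating space would be a copy of the complex field,
   on which [D] vanishes. *)
Lemma sep_trivial s : sep N D s -> s = 0.
Proof.
move=> hs; apply/eqP/negPn/negP => s_n0.
have [a [s0 hs0 /eqP as0] Hmin] :=
  sep_minimal_multiple bN Dlin Dmul (ex_intro2 _ _ s hs s_n0).
have [b hb] : exists b, ~ invertible (1 - b * (a * s0)).
  apply: contrapT => H; apply: as0; apply: semisimpleB => b.
  by apply: contrapT => h; apply: H; exists b.
pose s1 := b * s0; have hs1 : sep N D s1 by exact: sepM.
have [p pE] : exists p, p = a * s1 by exists (a * s1).
have hp : sep N D p by rewrite pE; exact: sepM.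
have np : ~ invertible (1 - p) by move: hb; rewrite mulrCA pE.
have p0 : p != 0.
  by apply/eqP => e; apply: np; exists 1; rewrite e subr0 mulr1.
(* Minimality for [1 - p]: either [p - p * p = 0], or [p] is close to some [a * (1 - p) * t], and
   then [1 - p] divides an invertible element. *)
have pp : p * p = p.
  case: (Hmin (1 - p)) => [/(_ _ hs1) h | /(_ _ hs1)].
    by apply/eqP; rewrite eq_sym -subr_eq0 -[X in _ == X]h pE; apply/eqP; ring.
  move=> /(_ (2^-1)) []; first by rewrite invr_gt0.
  move=> t ht /ltW /(neumann_invertible bN) [v hv]; exfalso; apply: np.
  by exists ((1 + a * t) * v); rewrite -[RHS]hv pE; ring.
(* Take a spectral value [l] of [p * y] and [z = l - y]. If [p * z] is not 0, minimality brings
   [a * z * t] close to [p], which makes [p * z] invertible in [p B]. *)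
have field y : exists l : R[i], p * y = l *: p.
  have [|l hl] := @exists_spectral_value _ _ _ bN p (p * y) pp p0; first by rewrite mulrA pp.
  exists l; pose z := l%:A - y.
  have pz : p * z = l *: p - p * y by rewrite mulrBr mulr_algr.
  case: (Hmin z) => [/(_ _ hs1) h | /(_ _ hs1)].
    apply/esym/eqP; rewrite -subr_eq0 -pz -[X in _ == X]h; apply/eqP; rewrite pE; ring.
  have e0 : 0 < (2 * (N p + 1))^-1 by rewrite invr_gt0; have := bnorm_ge0 bN p; lra.
  move=> /(_ _ e0) [t ht]; rewrite -pE => h.
  have [|v hv] := @neumann_invertible _ _ _ bN (p * (p - a * z * t)).
    apply: le_trans (bnormM bN _ _) _; rewrite mulrC -ler_pdivlMr; last first.
      by rewrite lt_neqAle (bnorm_ge0 bN) andbT eq_sym; apply: contraNneq p0 => /(bnorm_eq0 bN) ->.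
    apply: le_trans (ltW h) _; rewrite invfM ler_wpM2l ?invr_ge0 //.
    rewrite lef_pV2 ?posrE ?lerDl //.
      by have := bnorm_ge0 bN p; lra.
    by rewrite lt_neqAle (bnorm_ge0 bN) andbT eq_sym; apply: contraNneq p0 => /(bnorm_eq0 bN) ->.
  exfalso; apply: hl; exists (a * t * v).
  have pq : p * (1 - p * (p - a * z * t)) = p * z * (a * t).
    by rewrite mulrBr mulr1 (mulrA p p) pp mulrBr pp; ring.
  by rewrite -pz mulrA -pq -(mulrA p) hv mulr1.
have Dp : D p = 0.
  have h : D p = D p * p + p * D p by rewrite -Dmul pp.
  have h1 : p * D p = 0.
    have : p * D p = p * D p + p * D p.
      have : p * D p = p * (D p * p + p * D p) by rewrite -h.
      by rewrite mulrDr (mulrC (D p)) !mulrA pp.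
    by move=> /esym /eqP; rewrite -subr_eq0 addrK => /eqP.
  by rewrite h (mulrC (D p)) h1 addr0.
(* With [D x] within 1/2 of [p] and [p * D x = 0], the norm of [p] is at most half of itself. *)
have [|x [_ hx]] := hp 2^-1; first by rewrite invr_gt0.
have [l hl] := field x.
have pDx : p * D x = 0.
  have : D (p * x) = 0 by rewrite hl (linear_scale Dlin) Dp scaler0.
  by rewrite Dmul Dp mul0r add0r.
have : p = - (p * (D x - p)) by rewrite mulrBr pDx pp sub0r opprK.
move=> /(congr1 N); rewrite (bnormN bN) => h.
have := bnormM bN p (D x - p); rewrite -h => h1.
suff : N p = 0 by move=> /(bnorm_eq0 bN) /eqP; rewrite (negbTE p0).
by have := bnorm_ge0 bN p; nra.
Qed.

(** Since [sep] is zero, [D] is bounded; each [b * D] is then a bounded derivation, so every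
    [1 - b * D a] is invertible. *)
Lemma semisimple_derivation_eq0 a : D a = 0.
Proof.
have [C C0 HC] := sep_quotient_bounded bN Dlin Dmul.
have {}HC z : N (D z) <= C * N z.
  by have [s /sep_trivial ->] := HC z; rewrite subr0.
apply: semisimpleB => b.
apply: (@bounded_derivation_invertible _ _ _ bN (fun x => b * D x) _ _ (N b * C) a).
- by move=> k x y; rewrite Dlin mulrDr scalerAr.
- by move=> x y; rewrite Dmul; ring.
- move=> z; apply: le_trans (bnormM bN _ _) _; rewrite -mulrA ler_wpM2l //.
  exact: (bnorm_ge0 bN).
Qed.

End Johnson.

(** * The corner of a right identity *)

(** Positive elements of [R[i]] are real, so its Cauchy condition can be tested on real [eps]. *)
Lemma complete_real_norm (R : realType) (A : completeNormedModType R[i]) (u : nat -> A) :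
  (forall eps : R, 0 < eps -> exists n0, forall m n,
      (n0 <= m)%N -> (n0 <= n)%N -> complex.Re `|u m - u n| < eps) ->
  exists l, forall eps : R, 0 < eps -> exists n0, forall n,
      (n0 <= n)%N -> complex.Re `|u n - l| < eps.
Proof.
move=> H.
have ReE (x : A) : (complex.Re `|x|)%:C = `|x| by rewrite RRe_real // normr_real.
have epsE (eps : R[i]) : 0 < eps -> (complex.Re eps)%:C = eps /\ 0 < complex.Re eps.
  move=> e0; have h : (complex.Re eps)%:C = eps by rewrite RRe_real // gtr0_real.
  by split=> //; rewrite -ltcR h.
have : cvg (u @ \oo)%classic.
  apply/cauchy_cvgP/cauchy_exP => eps /epsE [eE e0].
  have [n0 hn0] := H _ e0; exists (u n0).
  exists n0 => // n /= hn; rewrite -ball_normE /ball_ /= -eE -ReE.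
  by have := hn0 _ _ (leqnn _) hn; rewrite -ltcR.
move=> /cvg_ex [l /cvgrPdist_lt hl]; exists l => eps e0.
have /hl [n0 _ hn0] : 0 < eps%:C by rewrite ltcR.
exists n0 => n /hn0 /=; rewrite distrC -ReE => h; rewrite -ltcR; exact: h.
Qed.

Section BilinearProduct.
Variables (R : realType) (A : completeNormedModType R[i]) (mul : A -> A -> A).
Local Notation "x ** y" := (mul x y) (at level 40, left associativity).
Hypothesis algA : is_normed_algebra_mul mul.

Lemma prodA x y z : x ** (y ** z) = x ** y ** z. Proof. by case: algA. Qed.
Lemma prodDr x y z : x ** (y + z) = x ** y + x ** z.
Proof. by case: algA => _ /(_ x 1 y z) + _ _; rewrite !scale1r. Qed.
Lemma prodDl x y z : (x + y) ** z = x ** z + y ** z.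
Proof. by case: algA => _ _ /(_ z 1 x y) + _; rewrite !scale1r. Qed.
Lemma prod0r x : x ** 0 = 0.
Proof. by apply: (addrI (x ** 0)); rewrite -prodDr !addr0. Qed.
Lemma prod0l x : 0 ** x = 0.
Proof. by apply: (addrI (0 ** x)); rewrite -prodDl !addr0. Qed.
Lemma prodZr k x y : x ** (k *: y) = k *: (x ** y).
Proof. by case: algA => _ /(_ x k y 0) + _ _; rewrite prod0r !addr0. Qed.
Lemma prodZl k x y : (k *: x) ** y = k *: (x ** y).
Proof. by case: algA => _ _ /(_ y k x 0) + _; rewrite prod0l !addr0. Qed.
Lemma prodNr x y : x ** (- y) = - (x ** y).
Proof. by rewrite -scaleN1r prodZr scaleN1r. Qed.
Lemma prodNl x y : (- x) ** y = - (x ** y).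
Proof. by rewrite -scaleN1r prodZl scaleN1r. Qed.
Lemma prodBr x y z : x ** (y - z) = x ** y - x ** z.
Proof. by rewrite prodDr prodNr. Qed.
Lemma prodBl x y z : (x - y) ** z = x ** z - y ** z.
Proof. by rewrite prodDl prodNl. Qed.
Lemma prod_norm x y : `|x ** y| <= `|x| * `|y|. Proof. by case: algA. Qed.

Variable e : A.
Hypotheses (mule : forall a, a ** e = a) (e_neq0 : e != 0).
Hypothesis comm_ann : forall x a b, x ** (a ** b) = x ** (b ** a).

Definition corner_pred (x : A) : bool := e ** x == x.

Fact corner_submod_closed : subsemimod_closed corner_pred.
Proof.
split; first split.
- by rewrite unfold_in /corner_pred prod0r.
- by move=> x y; rewrite !unfold_in /corner_pred prodDr => /eqP -> /eqP ->.
- by move=> k x; rewrite !unfold_in /corner_pred prodZr => /eqP ->.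
Qed.
HB.instance Definition _ := GRing.isSubmodClosed.Build R[i] A corner_pred corner_submod_closed.

(* [e A], a commutative unital complement of the right annihilator. *)
Record corner := Corner { cval : A; cvalP : corner_pred cval }.
HB.instance Definition _ := [isSub for cval].
HB.instance Definition _ := [Choice of corner by <:].
HB.instance Definition _ := [SubChoice_isSubLmodule of corner by <:].

Lemma corner_proof (x : A) : corner_pred (e ** x).
Proof. by rewrite /corner_pred prodA mule. Qed.
Definition to_corner (x : A) : corner := Corner (corner_proof x).

Lemma corner_fix (x : corner) : e ** cval x = cval x.
Proof. by apply/eqP; exact: cvalP. Qed.

(** The product is already fixed by [e]; the factor [e] added by [to_corner] makes commutativity an
    instance of [comm_ann]. *)
Let cmul (x y : corner) : corner := to_corner (cval x ** cval y).

Let cmulE x y : cval (cmul x y) = cval x ** cval y.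
Proof. by rewrite /= prodA corner_fix. Qed.

Let cmulA : associative cmul.
Proof. by move=> x y z; apply: val_inj; rewrite [LHS]cmulE [RHS]cmulE !cmulE prodA. Qed.
Let cmulC : commutative cmul.
Proof. by move=> x y; apply: val_inj => /=; exact: comm_ann. Qed.
Let cmul1 : left_id (to_corner e) cmul.
Proof. by move=> x; apply: val_inj => /=; rewrite mule prodA mule corner_fix. Qed.
Let cmulDl : left_distributive cmul +%R.
Proof. by move=> x y z; apply: val_inj => /=; rewrite prodDl prodDr. Qed.
Let corner1_neq0 : to_corner e != 0.
Proof. by rewrite -val_eqE /= mule. Qed.
HB.instance Definition _ :=
  GRing.Zmodule_isComNzRing.Build corner cmulA cmulC cmul1 cmulDl corner1_neq0.
Let cscaleAl (k : R[i]) (x y : corner) : k *: (x * y) = (k *: x) * y.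
Proof. by apply: val_inj => /=; rewrite prodZl prodZr. Qed.
HB.instance Definition _ := GRing.Lmodule_isLalgebra.Build R[i] corner cscaleAl.
HB.instance Definition _ := GRing.Lalgebra_isComAlgebra.Build R[i] corner.

Lemma cvalM (x y : corner) : cval (x * y) = cval x ** cval y.
Proof. exact: cmulE. Qed.

Let nrm (x : A) : R := complex.Re `|x|.

Let nrmE x : (nrm x)%:C = `|x|.
Proof. by rewrite /nrm RRe_real // normr_real. Qed.

Let nrmD x y : nrm (x + y) <= nrm x + nrm y.
Proof. by rewrite -lecR rmorphD /= !nrmE; exact: ler_normD. Qed.

Let nrmM x y : nrm (x ** y) <= nrm x * nrm y.
Proof. by rewrite -lecR rmorphM /= !nrmE; exact: prod_norm. Qed.

Let nrmN x : nrm (- x) = nrm x. Proof. by rewrite /nrm normrN. Qed.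

Let nrm_ge0 x : 0 <= nrm x.
Proof. by rewrite -lecR nrmE; exact: normr_ge0. Qed.

Let nrm_eq0 x : nrm x = 0 -> x = 0.
Proof. by move=> h; apply/eqP; rewrite -normr_eq0 -nrmE h. Qed.

Lemma corner_banach_norm : banach_norm (fun x : corner => nrm (cval x)).
Proof.
split.
- by move=> x y; exact: nrmD.
- move=> k x; apply: (@complexI R); rewrite rmorphM /= !nrmE normrZ.
  by congr (_ * _); case: (k).
- by move=> x y; rewrite cvalM; exact: nrmM.
- by move=> x /nrm_eq0 h; exact: val_inj.
move=> u hu; have [l hl] := @complete_real_norm R A (fun n => cval (u n)) hu.
(* The corner is closed, being the zero set of the continuous map [e ** x - x]. *)
have el : e ** l = l.
  apply/eqP; rewrite -subr_eq0; apply/eqP; apply: nrm_eq0; apply/eqP.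
  rewrite eq_le nrm_ge0 andbT leNgt; apply/negP => h.
  have k0 : 0 < nrm e + 1 by have := nrm_ge0 e; lra.
  have [n0 /(_ n0 (leqnn _))] := hl _ (divr_gt0 h k0).
  rewrite -/(nrm _) ltr_pdivlMr // => h1.
  have : nrm (e ** l - l) <= nrm (e ** (l - cval (u n0))) + nrm (cval (u n0) - l).
    apply: le_trans (nrmD _ _); rewrite prodBr corner_fix.
    by rewrite addrA subrK.
  have := nrmM e (l - cval (u n0)).
  by rewrite -(nrmN (l - _)) opprB; have := nrm_ge0 (cval (u n0) - l); nra.
by exists (Corner (introT eqP el)) => eps /hl.
Qed.

Hypothesis rad_ann : forall x, jacobson_rad mul x -> forall a, a ** x = 0.

(** Such an [x] lies in the radical of [A]: split [a ** x] as [w + n] with [w] in the corner and [n]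
    right annihilating, and extend the quasi-inverse of [w] to one of [w + n]. *)
Lemma corner_semisimple : semisimple_alg corner.
Proof.
move=> x hx; apply: val_inj => /=; rewrite -corner_fix; apply: rad_ann => a.
have [y hy] := hx (to_corner a).
set w := cval (to_corner a * x).
have cy : (e - w) ** cval y = e.
  by have := congr1 cval hy; rewrite cvalM /= mule.
have hw1 : e ** w = w by exact: corner_fix.
have hy1 : e ** cval y = cval y by exact: corner_fix.
have wy : w ** cval y = cval y - e by rewrite -[X in _ - X]cy prodBl hy1 opprB addrC subrK.
have yw : cval y ** w = cval y - e.
  by rewrite -wy -!cvalM mulrC.
pose y' := e - cval y.
have wy' : w ** y' = w + y' by rewrite prodBr mule wy opprB.
have yw' : y' ** w = w + y' by rewrite prodBl hw1 yw opprB.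
pose n := a ** cval x - w.
have hn b : b ** n = 0.
  by rewrite prodBr /w cvalM /= !prodA mule subrr.
(* Chosen so that [n ** y' = n + m], while [m] is again right annihilating. *)
pose m := n ** y' - n.
have hm b : b ** m = 0 by rewrite prodBr prodA hn prod0l subrr.
have ny' : n ** y' = n + m by rewrite addrC subrK.
have -> : a ** cval x = w + n by rewrite addrC subrK.
exists (y' + m); split; apply/eqP; rewrite subr_eq0; apply/eqP.
  by rewrite prodDr hm addr0 prodDl wy' ny' addrACA.
have mw : m ** w = n + m by rewrite prodBl -prodA yw' prodDr addrAC subrr add0r ny'.
by rewrite prodDr hn addr0 prodDl yw' mw addrACA (addrC y') (addrC m).
Qed.

(** Johnson's theorem kills [e d] on the corner, and the Leibniz rule shows that [d] preserves the
    right annihilator, which contains [a - e ** a]. *)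
Lemma derivation_ann d : is_derivation mul d -> forall x a, x ** d a = 0.
Proof.
move=> [dlin dmul] x a.
have dB u v : d (u - v) = d u - d v by have := dlin (-1) v u; rewrite !scaleN1r !(addrC (- _)).
have d0 : d 0 = 0 by have := dB 0 0; rewrite !subrr.
pose cd (z : corner) : corner := to_corner (d (cval z)).
have cdlin : linear cd.
  by move=> k u v; apply: val_inj; rewrite /= dlin prodDr prodZr.
have cdmul u v : cd (u * v) = cd u * v + u * cd v.
  apply: val_inj; transitivity (e ** d (cval (u * v))) => //.
  transitivity (cval (cd u * v) + cval (u * cd v)) => //.
  rewrite !cvalM dmul prodDr prodA; congr (_ + _).
  by rewrite /= !prodA mule corner_fix.
have := semisimple_derivation_eq0 corner_banach_norm corner_semisimple cdlin cdmul (to_corner a).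
move=> /(congr1 cval) /= h.
have hn b : b ** (a - e ** a) = 0 by rewrite prodBr prodA mule subrr.
have : x ** d (a - e ** a) = 0.
  have := dmul x (a - e ** a); rewrite hn d0.
  move=> /esym /eqP; rewrite addr_eq0 => /eqP h1.
  have := hn (d x).
  by move=> h2; rewrite h2 in h1; apply: oppr_inj; rewrite -h1 oppr0.
rewrite dB prodBr => /eqP; rewrite subr_eq0 => /eqP ->.
by rewrite -(mule x) -prodA h prod0r.
Qed.

End BilinearProduct.

(** * Equivalence of the three conditions *)

Theorem theorem4p10 (R : realType) (A : completeNormedModType R[i])
  (mul : A -> A -> A) (delta d : A -> A) :
  is_normed_algebra_mul mul ->
  jacobson_rad mul = rann mul ->
  (forall a b : A, alg_commutator mul a b \in jacobson_rad mul) ->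
  (exists e : A, forall a : A, mul a e = a) ->
  is_generalized_derivation mul delta d ->
  [/\ ((forall a : A,
          alg_commutator mul (alg_commutator mul (delta a) a) (delta a) \in alg_center mul)
        <-> maps_orthogonal mul d delta),
      (maps_orthogonal mul d delta
        <-> is_generalized_derivation mul (delta \o delta) (d \o d)) &
      ((forall a : A,
          alg_commutator mul (alg_commutator mul (delta a) a) (delta a) \in alg_center mul)
        <-> is_generalized_derivation mul (delta \o delta) (d \o d))].
Proof.
move=> algA radE comm_rad [e mule] [derd deltalin deltaM].
have mA := prodA algA; have mDr := prodDr algA; have mDl := prodDl algA.
have mBr := prodBr algA; have mBl := prodBl algA.
have m0r := prod0r algA; have m0l := prod0l algA.
have [dlin dmul] := derd.
have comm x a b : mul x (mul a b) = mul x (mul b a).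
  have := comm_rad a b; rewrite radE inE => /(_ x).
  by rewrite /alg_commutator mBr => /eqP; rewrite subr_eq0 => /eqP.
have md x a : mul x (d a) = 0.
  (* The corner is a nonzero ring only for [e != 0]; if [e = 0] all products vanish. *)
  have [e0 | e0] := eqVneq e 0.
    by rewrite -(mule (mul x (d a))) e0 m0r.
  apply: (@derivation_ann R A mul algA e mule e0 comm _ d derd).
  by move=> y; rewrite radE => h b; exact: h.
have dD x y : d (x + y) = d x + d y by have := dlin 1 x y; rewrite !scale1r.
have dB x y : d (x - y) = d x - d y.
  by apply: (addIr (d y)); rewrite -dD !subrK.
have deltaD x y : delta (x + y) = delta x + delta y.
  by have := deltalin 1 x y; rewrite !scale1r.
pose u := delta e.
have deltaE a : delta a = mul a u + d a by rewrite -{1}(mule a) deltaM mule.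
have double0 (x : A) : x + x = 0 -> x = 0.
  move=> /eqP; rewrite -mulr2n -scaler_nat scaler_eq0 pnatr_eq0 /= => /eqP //.
pose Q := forall a, mul (d a) u = 0.
(* Behind a leftmost factor, all further factors can be permuted. *)
have slide x y z : mul x (mul y z) = mul (mul x z) y by rewrite comm mA.
have QE : Q -> forall a b, mul (d a) (delta b) = 0.
  by move=> q a b; rewrite deltaE mDr md addr0 slide q m0l.
have commE a : alg_commutator mul (alg_commutator mul (delta a) a) (delta a) =
    mul (d a) (mul a (mul a u)).
  have c1 : alg_commutator mul (delta a) a = mul (d a) a.
    rewrite /alg_commutator deltaE mDl mDr md addr0 -mA (comm a u a).
    by rewrite addrAC subrr add0r.
  rewrite c1 /alg_commutator mA md m0l subr0 deltaE mDr md addr0 mA.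
  by rewrite !mA.
have condiE : (forall a, alg_commutator mul (alg_commutator mul (delta a) a) (delta a)
    \in alg_center mul) <-> Q.
  split=> [H | q a]; last first.
    by rewrite commE inE => x; rewrite (slide _ a) slide q !m0l m0r.
  pose F x y z := mul (d x) (mul y (mul z u)).
  (* Compare the two products of the central element [F a a a] with [e]: on the right [e] fixes it,
     on the left it gives 0, since [d] has right annihilating values. *)
  have F0 a : F a a a = 0.
    have := H a; rewrite commE inE => /(_ e).
    by rewrite mule -/(F a a a) => ->; rewrite /F mA md m0l.
  have due : mul (d e) u = 0.
    have := F0 e; rewrite /F (slide _ e) slide.
    by rewrite !mule.
  have Fe y z : F e y z = 0 by rewrite /F !slide due !m0l.
  have Faee a : F a e e = mul (d a) u by rewrite /F !slide !mule.
  have FC x y z : F x y z = F x z y by rewrite /F slide -mA -slide mA slide.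
  have FD2 x y y' z : F x (y + y') z = F x y z + F x y' z by rewrite /F mDl mDr.
  have FD3 x y z z' : F x y (z + z') = F x y z + F x y z' by rewrite FC FD2 !(FC x _ y).
  have FB2 x y y' z : F x (y - y') z = F x y z - F x y' z by rewrite /F mBl mBr.
  have FB3 x y z z' : F x y (z - z') = F x y z - F x y z' by rewrite FC FB2 !(FC x _ y).
  have FDe a y z : F (a + e) y z = F a y z by rewrite {1}/F dD mDl -!/(F _ _ _) Fe addr0.
  have FBe a y z : F (a - e) y z = F a y z by rewrite {1}/F dB mBl -!/(F _ _ _) Fe subr0.
  (* Polarization: the parts of [F] at [a + e] and [a - e] of odd degree in [e] cancel. *)
  move=> a; rewrite -Faee; apply: double0.
  have := F0 (a + e); rewrite FDe FD2 !FD3 F0 add0r (FC a e a) addrA.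
  move=> /eqP; rewrite addr_eq0 => /eqP FP.
  have := F0 (a - e); rewrite FBe FB2 !FB3 F0 sub0r (FC a e a) opprB addrCA -opprD FP.
  by rewrite opprK.
have condiiE : maps_orthogonal mul d delta <-> Q.
  split=> [H a | q a b c]; first by have [h _] := H a e e; rewrite mule in h.
  by rewrite -!mA slide QE // m0l !md m0r.
have condiiiE : is_generalized_derivation mul (delta \o delta) (d \o d) <-> Q.
  (* The cross term [mul (d a) (delta b)] occurs twice and is the only obstruction; [b = e] turns it
     into [mul (d a) u]. *)
  have dd2 a b : delta (delta (mul a b)) =
      mul a (delta (delta b)) + mul (d a) (delta b) + (mul (d a) (delta b) + mul (d (d a)) b).
    by rewrite deltaM deltaD !deltaM.
  split=> [[_ _ H] a | q].
    have := H a e; rewrite /= dd2 -addrA => /addrI; rewrite addrA => /eqP.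
    by rewrite -subr_eq0 addrK => /eqP /double0.
  split; last by move=> a b; rewrite /= dd2 QE // addr0 add0r.
    split; first by move=> k x y; rewrite /= !dlin.
    by move=> a b; rewrite /= dmul dD !dmul !md add0r addr0.
  by move=> k x y; rewrite /= !deltalin.
by split; rewrite ?condiE ?condiiE ?condiiiE.
Qed.
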